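(* Let $G$ be a finite graph on the vertex set $[n]=\{1,\dots,n\}$ without multiple edges, possibly with loops, and let $I=I(G)\subset S=K[x_1,\dots,x_n]$ be its edge ideal. The following conditions are equivalent: (a) $G$ is gap free; (b) $\operatorname{index}(I^{k})>1$ for all $k\geq 1$, i.e. $I^k$ is linearly presented for all $k\geq 1$; (c) $\operatorname{index}(I^{k})>1$ for some $k\geq 1$, i.e. $I^k$ is linearly presented for some $k\geq 1$.
   Context: $K$ is a field and $S=K[x_1,\dots,x_n]$ is the standard graded polynomial ring. The edge ideal of a graph $G$ on $[n]$ (no multiple edges, loops allowed) is the monomial ideal $I(G)\subset S$ generated by the monomials $x_ix_j$ with $\{i,j\}\in E(G)$; a loop at $i$ is the case $i=j$, giving the generator $x_i^2$ (the loop is regarded as the set $\{i\}$). A graph $G$ is gap free if for any two disjoint edges $e,e'\in E(G)$ there exists an edge $f\in E(G)$ such that $e\cap f\neq\emptyset\neq e'\cap f$. For a nonzero graded ideal $J\subset S$ generated in a single degree $d$, with graded Betti numbers $\beta_{i,j}(J)=\dim_K\operatorname{Tor}_i^S(J,K)_j$, $J$ is called $r$ steps linear if $\beta_{i,i+j}(J)=0$ for all pairs $(i,j)$ with $0\leq i\leq r$ and $j>d$. The index of $J$ is $\operatorname{index}(J)=\sup\{r : J \text{ is } r \text{ steps linear}\}+1$ (so $\operatorname{index}(J)=\infty$ if and only if $J$ has a linear resolution). $J$ is linearly presented if $\operatorname{index}(J)>1$. By convention the index of the zero ideal is $\infty$. *)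

(* Defs.v *)
From mathcomp Require Import all_boot all_order all_algebra zify.
From mathcomp.multinomials Require Export mpoly.
From Stdlib Require Import ClassicalEpsilon.

Set Implicit Arguments.
Unset Strict Implicit.
Unset Printing Implicit Defensive.

Import GRing.Theory.
Local Open Scope ring_scope.

(* Suprema in the natural numbers extended by oo; the supremum of the empty   *)
(* set is 0.                                                                  *)
Inductive enat := Fin of nat | Inf.

Definition enat_lt (a b : enat) : Prop :=
  match a, b with
  | Fin p, Fin q => (p < q)%N
  | Fin _, Inf => True
  | Inf, _ => False
  end.

Definition enat_succ (a : enat) : enat := if a is Fin p then Fin p.+1 else Inf.

Definition is_lub (P : nat -> Prop) (s : nat) : Prop :=
  (forall r, P r -> (r <= s)%N) /\
  (forall t, (forall r, P r -> (r <= t)%N) -> (s <= t)%N).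

Definition enat_sup (P : nat -> Prop) : enat :=
  match excluded_middle_informative (exists s, is_lub P s) with
  | left h => Fin (sval (constructive_indefinite_description _ h))
  | right _ => Inf
  end.

(* The edge set consists of sets {i, j}, the case i = j being a loop at i.    *)
Record loopgraph (n : nat) := LoopGraph {
  edges :> {set {set 'I_n}};
  edges_card : forall e, e \in edges -> (1 <= #|e| <= 2)%N }.

Definition gap_free (n : nat) (G : loopgraph n) : Prop :=
  forall e e', e \in edges G -> e' \in edges G -> [disjoint e & e'] ->
  exists f, [/\ f \in edges G, e :&: f != set0 & e' :&: f != set0].

Definition ideal_gen (R : comNzRingType) (A : R -> Prop) (f : R) : Prop :=
  exists s : seq (R * R),
    (forall p, p \in s -> A p.2) /\ f = \sum_(p <- s) p.1 * p.2.

Definition ideal_mul (R : comNzRingType) (I J : R -> Prop) : R -> Prop :=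
  ideal_gen (fun f => exists a b, [/\ I a, J b & f = a * b]).

Definition ideal_pow (R : comNzRingType) (I : R -> Prop) (k : nat) : R -> Prop :=
  iter k (ideal_mul I) (fun _ => True).

Definition edge_ideal (K : fieldType) (n : nat) (G : loopgraph n) :
    {mpoly K[n]} -> Prop :=
  ideal_gen (fun f => exists i j, [set i; j] \in edges G /\ f = 'X_i * 'X_j).

Arguments edge_ideal K {n} G _.

Section Tor.
Variables (K : fieldType) (n : nat).
Local Notation S := {mpoly K[n]}.

(* f belongs to S(-a)_j                                                       *)
Definition shift_homog (a j : nat) (f : S) : bool :=
  all (fun m : 'X_{1..n} => (a + mdeg m)%N == j) (msupp f).

(* A graded map between the free modules with bases B and C, given by its     *)
(* matrix d, acting on coordinate vectors.                                    *)
Definition free_map (B C : finType) (d : B -> C -> S) (v : {ffun B -> S}) :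
    {ffun C -> S} :=
  [ffun c => \sum_(b : B) v b * d b c].

(* A graded free resolution ... -> F_1 -> F_0 -> K -> 0 of K = S/(x_1,..,x_n) *)
(* by modules F_i = \bigoplus_(b in res_basis i) S(-(res_deg b)); S acts on K *)
(* through the constant coefficient, and K sits in degree 0.                  *)
Record free_resolution := FreeResolution {
  res_basis : nat -> finType;
  res_deg : forall i, res_basis i -> nat;
  res_diff : forall i, res_basis i.+1 -> res_basis i -> S;
  res_aug : res_basis 0 -> K;
  res_diff_homog : forall i b c,
    shift_homog (@res_deg i c) (@res_deg i.+1 b) (@res_diff i b c);
  res_aug_homog : forall b, res_aug b != 0 -> @res_deg 0 b = 0;
  res_complex : forall i v,
    free_map (@res_diff i) (free_map (@res_diff i.+1) v) = 0;
  res_aug_complex : forall v,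
    \sum_b (free_map (@res_diff 0) v b)@_0%MM * res_aug b = 0;
  res_exact : forall i v, free_map (@res_diff i) v = 0 ->
    exists u, v = free_map (@res_diff i.+1) u;
  res_aug_exact : forall v : {ffun res_basis 0 -> S},
    \sum_b (v b)@_0%MM * res_aug b = 0 ->
    exists u, v = free_map (@res_diff 0) u;
  res_aug_surj : exists b, res_aug b != 0 }.

(* For an ideal J of S, the degree j component of J (x) F_i, which is the     *)
(* direct sum of the J(-(res_deg b)).                                         *)
Definition tensor_chain (F : free_resolution) (J : S -> Prop) (i j : nat)
    (v : {ffun res_basis F i -> S}) : Prop :=
  forall b, J (v b) /\ shift_homog (res_deg b) j (v b).

Definition tensor_cycle (F : free_resolution) (J : S -> Prop) (i j : nat) :
    {ffun res_basis F i -> S} -> Prop :=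
  match i with
  | 0 => fun v => tensor_chain J j v
  | i'.+1 => fun v => tensor_chain J j v /\ free_map (@res_diff F i') v = 0
  end.

Definition tensor_boundary (F : free_resolution) (J : S -> Prop) (i j : nat)
    (v : {ffun res_basis F i -> S}) : Prop :=
  exists u, tensor_chain J j u /\ v = free_map (@res_diff F i) u.

End Tor.

Section Koszul.
Variables (K : fieldType) (n : nat).
Local Notation S := {mpoly K[n]}.
Implicit Types (T U : {set 'I_n}) (x y : 'I_n) (m : 'X_{1..n}).
Implicit Type g : {set 'I_n} -> S.

(* The Koszul complex, with basis e_T, T ranging over the i-subsets:          *)
(* d(e_T) = \sum_(x in T) (-1)^#{y in T : y < x} x e_(T \ x).                 *)
Definition koszul_basis (i : nat) : finType := {T : {set 'I_n} | #|T| == i}.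

Definition koszul_diff (i : nat) (b : koszul_basis i.+1) (c : koszul_basis i) :
    S :=
  \sum_(x in val b | val c == val b :\ x)
    (-1) ^+ #|[set y in val b | (y < x)%N]| *: 'X_x.

Definition kext i (v : {ffun koszul_basis i -> S}) T : S :=
  \sum_(b | val b == T) v b.

Definition kD g U : S :=
  \sum_(x | x \notin U) (-1) ^+ #|[set y in U | (y < x)%N]| *: (g (x |: U) * 'X_x).

Lemma kext_val i (v : {ffun koszul_basis i -> S}) b : kext v (val b) = v b.
Proof. by rewrite /kext (big_pred1 b) // => c; rewrite val_eqE. Qed.

Lemma kext_out i (v : {ffun koszul_basis i -> S}) T : #|T| != i -> kext v T = 0.
Proof.
move=> hT; rewrite /kext big_pred0 // => b; apply: contraNF hT => /eqP <-.
exact: (valP b).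
Qed.

Lemma ksetU U x : [set y in x |: U | (y < x)%N] = [set y in U | (y < x)%N].
Proof.
by apply/setP => y; rewrite !inE; case: eqP => [->|]; rewrite ?ltnn ?andbF.
Qed.

Lemma kD_val i (v : {ffun koszul_basis i.+1 -> S}) c :
  free_map (@koszul_diff i) v c = kD (kext v) (val c).
Proof.
rewrite /free_map ffunE /kD.
under eq_bigr do rewrite /koszul_diff mulr_sumr.
rewrite (exchange_big_dep (fun x => x \notin val c)) /=; last first.
  by move=> b x _ /andP[_ /eqP ->]; rewrite !inE eqxx.
apply: eq_bigr => x hx; rewrite /kext mulr_suml scaler_sumr.
apply: eq_big => b.
  apply/andP/eqP => [[xb /eqP ->]|->]; first by rewrite setD1K.
  by rewrite setU11 setU1K.
by case/andP=> xb /eqP ->; rewrite -scalerAr -{1}(setD1K xb) ksetU.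
Qed.

Lemma kD_ext i (v : {ffun koszul_basis i.+1 -> S}) U :
  kext (free_map (@koszul_diff i) v) U = kD (kext v) U.
Proof.
have [hU|hU] := boolP (#|U| == i).
  by rewrite (_ : U = val (Sub U hU : koszul_basis i)) // kext_val kD_val.
rewrite kext_out // /kD big1 // => x hx.
by rewrite kext_out ?mul0r ?scaler0 // cardsU1 hx eqSS.
Qed.

Lemma ksgnU x y U : x \notin U ->
  (-1) ^+ #|[set z in x |: U | (z < y)%N]| =
  (-1) ^+ (x < y)%N * (-1) ^+ #|[set z in U | (z < y)%N]| :> K.
Proof.
move=> hx; rewrite -exprD; congr (_ ^+ _).
case: ltnP => xy; last first.
  rewrite add0n; apply: eq_card => z; rewrite !inE.
  by case: eqP => [->|//]; rewrite ltnNge xy !andbF.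
have -> : [set z in x |: U | (z < y)%N] = x |: [set z in U | (z < y)%N].
  by apply/setP => z; rewrite !inE; case: eqP => [->|//]; rewrite xy.
by rewrite cardsU1 !inE (negbTE hx).
Qed.

Lemma kDD g U : kD (kD g) U = 0.
Proof.
pose t x y : S := ((-1) ^+ #|[set z in U | (z < x)%N]|
  * (-1) ^+ #|[set z in U | (z < y)%N]|) *: (g (y |: (x |: U)) * 'X_y * 'X_x).
have tC x y : t x y = t y x.
  by rewrite /t setUCA mulrAC [X in X *: _]mulrC.
transitivity (\sum_(x | x \notin U) \sum_(y | (y \notin U) && (y != x))
    (-1) ^+ (x < y)%N *: t x y).
  apply: eq_bigr => x hx; rewrite /kD mulr_suml scaler_sumr.
  apply: eq_big => [y|y _]; first by rewrite !inE negb_or andbC.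
  rewrite ksgnU // /t -scalerAl !scalerA; congr (_ *: _).
  by rewrite mulrCA mulrA.
have split_sum (F : 'I_n -> 'I_n -> S) :
  \sum_(x | x \notin U) \sum_(y | (y \notin U) && (y != x)) F x y =
  \sum_(x | x \notin U) \sum_(y | (y \notin U) && (x < y)%N) F x y +
  \sum_(x | x \notin U) \sum_(y | (y \notin U) && (y < x)%N) F x y.
  rewrite -big_split; apply: eq_bigr => x _ /=.
  rewrite (bigID (fun y : 'I_n => (x < y)%N)) /=; congr (_ + _).
    apply: eq_bigl => y; rewrite -andbA; congr (_ && _).
    by rewrite andb_idl // => xy; rewrite -val_eqE /= gtn_eqF.
  by apply: eq_bigl => y; rewrite -andbA -leqNgt -ltn_neqAle.
rewrite split_sum [X in _ + X](exchange_big_dep (fun x => x \notin U)) /=;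
  last by move=> x y _ /andP[].
rewrite -big_split big1 // => x hx /=.
rewrite [X in _ + X](eq_bigl (fun y => (y \notin U) && (x < y)%N)); last first.
  by move=> y; rewrite hx.
rewrite -big_split big1 // => y /andP[_ xy] /=.
by rewrite xy ltnNge (ltnW xy) /= expr0 expr1 scale1r scaleN1r [t y x]tC addNr.
Qed.

Lemma mcoeffMXU (p : S) x m :
  (p * 'X_x)@_m = if (0 < m x)%N then p@_(m - U_(x))%MM else 0.
Proof.
case: ifPn => hm.
  have le1 : (U_(x) <= m)%MM by rewrite lep1mP -lt0n.
  by rewrite -{1}(submK le1) addmC mcoeffMX.
apply: memN_msupp_eq0; rewrite (perm_mem (msuppMX _ _)).
by apply: contra hm => /mapP[m' _ ->]; rewrite mnmDE mnm1E eqxx.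
Qed.

Lemma kDE g U m : (kD g U)@_m =
  \sum_(x | (x \notin U) && (0 < m x)%N)
     (-1) ^+ #|[set y in U | (y < x)%N]| * (g (x |: U))@_(m - U_(x))%MM.
Proof.
rewrite /kD raddf_sum /= big_mkcondr /=; apply: eq_bigr => x _.
by rewrite mcoeffZ mcoeffMXU; case: ifP => // _; rewrite mulr0.
Qed.

Definition kbelow x m T :=
  [forall y : 'I_n, (y < x)%N ==> (y \notin T) && (m y == 0%N)].

(* A contracting homotopy in every nonzero multidegree.                       *)
Definition kH g T : S :=
  \sum_(x in T) \sum_(m <- msupp (g (T :\ x)) | (0 < m x)%N && kbelow x m T)
     (g (T :\ x))@_m *: 'X_[(m - U_(x))%MM].

Lemma kHE g T m : (kH g T)@_m =
  \sum_(x in T | kbelow x m T) (g (T :\ x))@_(m + U_(x))%MM.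
Proof.
rewrite /kH raddf_sum /= big_mkcondr /=; apply: eq_bigr => x xT.
set p := g _; rewrite raddf_sum /=.
have E m' : (0 < m' x)%N -> ((m' - U_(x))%MM == m) = (m' == (m + U_(x))%MM).
  move=> h; have le1 : (U_(x) <= m')%MM by rewrite lep1mP -lt0n.
  by apply/eqP/eqP => [<-|->]; rewrite ?submK ?addmK.
have B : kbelow x (m + U_(x))%MM T = kbelow x m T.
  apply: eq_forallb => y; case: ltnP => //= yx.
  by rewrite mnmDE mnm1E -val_eqE /= (gtn_eqF yx) addn0.
case: ifPn => hb; last first.
  rewrite big1 // => m' /andP[h1 h2]; rewrite mcoeffZ mcoeffX E //.
  by case: eqP => [e|_]; rewrite ?mulr0 //; rewrite e B (negbTE hb) in h2.
have [hin|hout] := boolP ((m + U_(x))%MM \in msupp p); last first.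
  rewrite (memN_msupp_eq0 hout) big_seq_cond big1 // => m' /and3P[h0 h1 h2].
  rewrite mcoeffZ mcoeffX E //; case: eqP => [e|_]; rewrite ?mulr0 //.
  by rewrite -e h0 in hout.
rewrite big_mkcond (bigD1_seq _ hin) //= mnmDE mnm1E eqxx addn1 /= B hb.
rewrite mcoeffZ mcoeffX addmK eqxx mulr1 big1 ?addr0 // => m' hm'.
case: ifP => // /andP[h1 _]; rewrite mcoeffZ mcoeffX E //.
by rewrite (negbTE hm') mulr0.
Qed.

Lemma kbelow_uniq x y m T : kbelow x m T -> kbelow y m T ->
  (x \in T) || (0 < m x)%N -> (y \in T) || (0 < m y)%N -> x = y.
Proof.
move=> /forallP hx /forallP hy px py; apply: val_inj; apply/eqP.
rewrite eqn_leq leqNgt [X in _ && X]leqNgt; apply/andP; split; apply/negP => lt.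
  by have := hx y; rewrite lt /= => /andP[yT /eqP my]; move: py; rewrite (negbTE yT) my.
by have := hy x; rewrite lt /= => /andP[xT /eqP mx]; move: px; rewrite (negbTE xT) mx.
Qed.

Lemma kH1 g T m i : kbelow i m T -> i \in T ->
  (kH g T)@_m = (g (T :\ i))@_(m + U_(i))%MM.
Proof.
move=> bi iT; rewrite kHE (big_pred1 i) // => x /=.
apply/andP/eqP => [[xT bx]|->//]; apply: (kbelow_uniq bx bi); first by rewrite xT.
by rewrite iT.
Qed.

Lemma kH0 g T m i : kbelow i m T -> i \notin T -> (0 < m i)%N ->
  (kH g T)@_m = 0.
Proof.
move=> bi iT mi; rewrite kHE big_pred0 // => x.
apply/negP => /andP[xT bx]; have e : x = i.
  by apply: (kbelow_uniq bx bi); rewrite ?xT ?mi ?orbT.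
by rewrite -e xT in iT.
Qed.

Lemma ksgn_below i m U : kbelow i m U ->
  (-1) ^+ #|[set y in U | (y < i)%N]| = 1 :> K.
Proof.
move=> /forallP bi; rewrite (_ : [set _ in _ | _] = set0) ?cards0 //.
apply/setP => y; rewrite !inE; apply/negP => /andP[yU yi].
by have := bi y; rewrite yi yU.
Qed.

Lemma kbelow_step i x m U : (x \in U) || (0 < m x)%N -> kbelow i m U ->
  forall m' U', (forall y, y != x -> (m' y == m y) && ((y \in U') == (y \in U))) ->
  kbelow i m' U'.
Proof.
move=> px /forallP bi m' U' h; apply/forallP => y; apply/implyP => yi.
have := bi y; rewrite yi /= => /andP[yU my].
have yx : y != x.
  by apply/negP => /eqP e; move: px; rewrite -e (negbTE yU) (eqP my).
by have /andP[/eqP -> /eqP ->] := h y yx; rewrite yU my.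
Qed.

Lemma khomotopy g U m i : kbelow i m U -> (i \in U) || (0 < m i)%N ->
  (kD (kH g) U)@_m + (kH (kD g) U)@_m = (g U)@_m.
Proof.
move=> bi; have [iU _|iU /= mi] := boolP (i \in U); last first.
  rewrite (kH0 _ bi) // addr0 kDE.
  have b' x : (0 < m x)%N -> kbelow i (m - U_(x))%MM (x |: U).
    move=> mx; apply: (@kbelow_step i x m U) => //; first by rewrite mx orbT.
    move=> y yx; rewrite !inE (negbTE yx) /= eqxx andbT.
    by rewrite mnmBE mnm1E [x == y]eq_sym (negbTE yx) subn0.
  rewrite (bigD1 i) ?iU //= (ksgn_below bi) mul1r.
  rewrite (kH1 _ (b' _ mi)) ?setU11 // setU1K // submK; last first.
    by rewrite lep1mP -lt0n.
  rewrite big1 ?addr0 // => x /andP[/andP[xU mx] xi].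
  have [h|h] := posnP ((m - U_(x))%MM i); last first.
    by rewrite (kH0 _ (b' _ mx)) ?mulr0 // !inE eq_sym (negbTE xi).
  by move: h mi; rewrite mnmBE mnm1E (negbTE xi) subn0 => ->.
rewrite (kH1 _ bi iU) !kDE.
rewrite [X in _ + X](bigD1 i) /=; last first.
  by rewrite !inE eqxx /= mnmDE mnm1E eqxx addn1.
rewrite setD1K // addmK.
have bi' : kbelow i m (U :\ i).
  apply: (@kbelow_step i i m U) => //; first by rewrite iU.
  by move=> y yi; rewrite !inE yi !eqxx.
rewrite (ksgn_below bi') mul1r addrCA -[RHS]addr0; congr (_ + _).
rewrite [X in _ + X](eq_bigl (fun x => (x \notin U) && (0 < m x)%N)); last first.
  move=> x; rewrite !inE mnmDE mnm1E negb_and negbK.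
  have [->|xi] := eqVneq x i; first by rewrite iU andbF.
  by rewrite /= andbT addn0.
rewrite -big_split big1 // => x /andP[xU mx] /=.
have xi : x != i by apply: contraNneq xU => ->.
have ix : (i < x)%N.
  rewrite ltn_neqAle eq_sym val_eqE xi /= leqNgt; apply/negP => lt.
  by move/forallP: bi => /(_ x); rewrite lt -leqn0 leqNgt mx andbF.
rewrite (kH1 _ (i := i)) ?inE ?iU ?orbT //; last first.
  apply: (@kbelow_step i x m U) => //; first by rewrite mx orbT.
  move=> y yx; rewrite !inE (negbTE yx) /= eqxx andbT.
  by rewrite mnmBE mnm1E [x == y]eq_sym (negbTE yx) subn0.
have -> : (x |: U) :\ i = x |: (U :\ i).
  apply/setP => y; rewrite !inE.
  by have [->|] := eqVneq y x; rewrite ?xi ?andbT ?orbF.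
have -> : (m - U_(x) + U_(i) = m + U_(i) - U_(x))%MM.
  apply/mnmP => y; rewrite !(mnmDE, mnmBE) !mnm1E.
  by case: eqP => [<-|_]; rewrite ?(negbTE xi) ?subn0 //; lia.
have := @ksgnU i x (U :\ i); rewrite !inE eqxx /= setD1K // ix => -> //.
by rewrite expr1 -!mulrA mulN1r addNr.
Qed.

Lemma kbelow_exists m U : (m != 0%MM) || (U != set0) ->
  exists2 i, kbelow i m U & (i \in U) || (0 < m i)%N.
Proof.
move=> h; have [i0 hi0] : exists i, (i \in U) || (0 < m i)%N.
  case/orP: h => [h|/set0Pn[i iU]]; last by exists i; rewrite iU.
  have [/existsP[i mi]|] := boolP [exists i, (0 < m i)%N].
    by exists i; rewrite mi orbT.
  rewrite negb_exists => /forallP h0; case/negP: h; apply/eqP/mnmP => i.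
  by rewrite mnm0E; apply/eqP; have := h0 i; rewrite lt0n negbK.
have [i hi mini] := @arg_minnP _ i0 (fun i => (i \in U) || (0 < m i)%N) (@nat_of_ord n) hi0.
exists i => //; apply/forallP => y; apply/implyP; rewrite ltnNge => yi.
by rewrite -leqn0 leqNgt -negb_or; apply: contra yi; apply: mini.
Qed.

Lemma kD_exact g : kD g =1 (fun=> 0) -> (g set0)@_0%MM = 0 ->
  forall U, g U = kD (kH g) U.
Proof.
move=> Dg g0 U; apply/mpolyP => m.
have Hk : (kH (kD g) U)@_m = 0.
  by rewrite kHE big1 // => x _; rewrite Dg mcoeff0.
have [h|] := boolP ((m != 0%MM) || (U != set0)).
  by have [i bi hi] := kbelow_exists h; rewrite -(khomotopy g bi hi) Hk addr0.
rewrite negb_or !negbK => /andP[/eqP -> /eqP ->].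
by rewrite g0 kDE big1 // => x; rewrite mnm0E andbF.
Qed.

Lemma kext_kH i (v : {ffun koszul_basis i -> S}) :
  kD (kext v) =1 (fun=> 0) -> (kext v set0)@_0%MM = 0 ->
  exists u, v = free_map (@koszul_diff i) u.
Proof.
move=> Dv v0; exists [ffun b => kH (kext v) (val b)]; apply/ffunP => c.
rewrite kD_val -kext_val (kD_exact Dv v0); apply: eq_bigr => x hx.
have hb : #|x |: val c| == i.+1 by rewrite cardsU1 hx (eqP (valP c)).
by rewrite -[x |: _]/(val (Sub (x |: val c) hb : koszul_basis i.+1)) kext_val ffunE.
Qed.

Fact koszul_homog i b c : @shift_homog K n i i.+1 (@koszul_diff i b c).
Proof.
apply/allP => m; rewrite mcoeff_msupp /koszul_diff raddf_sum /= => nz.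
have [/existsP[x /eqP ->]|] := boolP [exists x, m == U_(x)%MM].
  by rewrite mdeg1 addn1.
rewrite negb_exists => /forallP h; case/eqP: nz; rewrite big1 // => x _.
by rewrite mcoeffZ mcoeffX eq_sym (negbTE (h x)) mulr0.
Qed.

Fact koszul_complex i v :
  free_map (@koszul_diff i) (free_map (@koszul_diff i.+1) v) = 0.
Proof.
apply/ffunP => c; rewrite kD_val ffunE.
transitivity (kD (kD (kext v)) (val c)); last exact: kDD.
by apply: eq_bigr => x _; rewrite kD_ext.
Qed.

Lemma koszul_aug (v : {ffun koszul_basis 0 -> S}) :
  \sum_b (v b)@_0%MM * 1 = (kext v set0)@_0%MM.
Proof.
rewrite /kext raddf_sum /=; apply: eq_big => [b|b _]; last by rewrite mulr1.
by rewrite -cards_eq0 (valP b).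
Qed.

Fact koszul_aug_complex v :
  \sum_b (free_map (@koszul_diff 0) v b)@_0%MM * 1 = 0.
Proof.
by rewrite koszul_aug kD_ext kDE big1 // => x; rewrite mnm0E andbF.
Qed.

Fact koszul_exact i v : free_map (@koszul_diff i) v = 0 ->
  exists u, v = free_map (@koszul_diff i.+1) u.
Proof.
move=> dv; apply: kext_kH; last by rewrite kext_out ?mcoeff0 ?cards0.
by move=> U; rewrite -kD_ext dv /kext big1 // => b _; rewrite ffunE.
Qed.

Fact koszul_aug_exact (v : {ffun koszul_basis 0 -> S}) :
  \sum_b (v b)@_0%MM * 1 = 0 -> exists u, v = free_map (@koszul_diff 0) u.
Proof.
rewrite koszul_aug => v0; apply: kext_kH => // U.
by rewrite /kD big1 // => x hx; rewrite kext_out ?mul0r ?scaler0 // cardsU1 hx.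
Qed.

Fact koszul_aug_surj : exists b : koszul_basis 0, (1 : K) != 0.
Proof.
have h : #|set0 : {set 'I_n}| == 0%N by rewrite cards0.
by exists (Sub set0 h); apply: oner_neq0.
Qed.

Definition koszul : free_resolution K n :=
  @FreeResolution K n koszul_basis (fun i _ => i) koszul_diff (fun=> 1)
    koszul_homog (fun _ _ => erefl) koszul_complex koszul_aug_complex
    koszul_exact koszul_aug_exact koszul_aug_surj.

End Koszul.

Definition indep_mod (K : fieldType) (V : lmodType K) (B : V -> Prop) (m : nat)
    (w : 'I_m -> V) : Prop :=
  forall a : 'I_m -> K, B (\sum_(l < m) a l *: w l) -> forall l, a l = 0.

(* The dimension of Z / B.                                                    *)
Definition quot_dim (K : fieldType) (V : lmodType K) (Z B : V -> Prop) : enat :=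
  enat_sup (fun m => exists w : 'I_m -> V, (forall l, Z (w l)) /\ indep_mod B w).

(* dim_K Tor_i(J, K)_j, computed from a graded free resolution F of K.        *)
Definition tor_dim (K : fieldType) (n : nat) (F : free_resolution K n)
    (J : {mpoly K[n]} -> Prop) (i j : nat) : enat :=
  quot_dim (@tensor_cycle K n F J i j) (@tensor_boundary K n F J i j).

Definition betti (K : fieldType) (n : nat) (J : {mpoly K[n]} -> Prop)
    (i j : nat) : enat :=
  tor_dim (koszul K n) J i j.

Definition generated_in_degree (K : fieldType) (n : nat)
    (J : {mpoly K[n]} -> Prop) (d : nat) : Prop :=
  exists A : {mpoly K[n]} -> Prop,
    (forall f, A f -> f \is d.-homog) /\ (forall f, J f <-> ideal_gen A f).

Definition steps_linear (K : fieldType) (n : nat) (J : {mpoly K[n]} -> Prop)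
    (r : nat) : Prop :=
  exists d, generated_in_degree J d /\
    forall i j, (i <= r)%N -> (d < j)%N -> betti J i (i + j) = Fin 0.

(* Only meaningful for zero ideals and ideals generated in a single degree.   *)
Definition ideal_index (K : fieldType) (n : nat) (J : {mpoly K[n]} -> Prop) : enat :=
  if excluded_middle_informative (forall f, J f -> f = 0) then Inf
  else enat_succ (enat_sup (steps_linear J)).

(* Main.v *)
(* For a monomial ideal J, Tor_1(J, K) in multidegree m is the reduced H_0 of
   the graph on the variables x with m / x in J in which x and y are adjacent
   when m / (xy) is in J.  Hence I^k is linearly presented if and only if this
   graph is connected for every m of degree at least 2k + 2.

   If e, e' is a gap, the graph of m = e^k e' separates the variables of e from
   those of e': an edge product of degree 2k dividing m / (xy), with x in e and
   y in e', would have even degree in each of the two sets of variables.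

   If G is gap free, let U and V be products of k edges dividing m.  Comparing
   exponents, some edge e of U can be exchanged for an edge f of V so that
   W = eV / f still divides m.  U and W share the edge e and are linked by
   induction on k; W and V share the other k - 1 edges, which reduces to k = 1,
   where two disjoint edges are linked through the edge that meets both. *)
Require Import Defs.
From mathcomp Require Import all_boot all_order all_algebra zify.
From Stdlib Require Import Relation_Operators ClassicalEpsilon.

Set Implicit Arguments.
Unset Strict Implicit.
Unset Printing Implicit Defensive.

Import GRing.Theory.

(** * The graph on the variables attached to a monomial *)

Section LinkedVariables.
Variable n : nat.
Implicit Types (P : 'X_{1..n} -> Prop) (m : 'X_{1..n}) (x y : 'I_n).

Definition var_adj P m x y : Prop :=
  (U_(x) + U_(y) <= m)%MM /\ P (m - (U_(x) + U_(y)))%MM.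

(** [var_adj] is symmetric, so this is connectedness by a path. *)
Definition var_linked P m : 'I_n -> 'I_n -> Prop :=
  clos_refl_trans _ (var_adj P m).

Lemma var_linked_sub P Q m m' :
  (forall x y, var_adj P m x y -> var_adj Q m' x y) ->
  forall x y, var_linked P m x y -> var_linked Q m' x y.
Proof.
move=> h x y; elim=> {x y}.
- by move=> x y /h; apply: rt_step.
- by move=> x; apply: rt_refl.
- by move=> x y z _ h1 _ h2; apply: rt_trans h1 h2.
Qed.

(** For distinct y and z, the least common multiple of V y and V z is V y z. *)
Lemma lep_mnm1D m (V : 'X_{1..n}) y z : y != z ->
  (V + U_(y) <= m)%MM -> (V + U_(z) <= m)%MM ->
  (V + (U_(y) + U_(z)) <= m)%MM.
Proof.
move=> yz /mnm_lepP hy /mnm_lepP hz; apply/mnm_lepP => t.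
have := hy t; have := hz t; rewrite !mnmDE !mnm1E.
have [<-|_] := eqVneq y t; first by rewrite [z == y]eq_sym (negbTE yz); lia.
by case: eqP; lia.
Qed.

Lemma lep_addB (V : 'X_{1..n}) W m : (V + W <= m)%MM -> (V <= m - W)%MM.
Proof.
by move=> /mnm_lepP h; apply/mnm_lepP => t; have := h t; rewrite mnmDE mnmBE; lia.
Qed.

Lemma lep_addr_trans (V : 'X_{1..n}) W m : (V + W <= m)%MM -> (V <= m)%MM.
Proof.
by move=> /mnm_lepP h; apply/mnm_lepP => t; have := h t; rewrite mnmDE; lia.
Qed.

Lemma lep_mdeg m (V : 'X_{1..n}) : (V <= m)%MM -> (mdeg V < mdeg m)%N ->
  exists x, (V + U_(x) <= m)%MM.
Proof.
move=> le lt; have : (m - V)%MM != 0%MM.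
  by apply/eqP => e; move: lt; rewrite -(submK le) e add0m ltnn.
rewrite -mdeg_eq0 mdegE sum_nat_eq0 negb_forall => /existsP[x /=].
rewrite mnmBE => h; exists x; apply/mnm_lepP => t.
by move/mnm_lepP: le => /(_ t); rewrite mnmDE mnm1E; case: eqP => [<-|]; lia.
Qed.

End LinkedVariables.

(** * Products of k edges and paths between the variables they leave over *)

Section EdgeProducts.
Variables (n : nat) (G : loopgraph n).
Implicit Types (m U V W : 'X_{1..n}) (x y z : 'I_n).

Inductive edge_prod : nat -> 'X_{1..n} -> Prop :=
| edge_prod0 : edge_prod 0 0%MM
| edge_prodS k i j U : [set i; j] \in edges G -> edge_prod k U ->
    edge_prod k.+1 (U_(i) + U_(j) + U)%MM.

(** The exponents of the monomials in I(G)^k, by [edge_idealP]. *)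
Definition edge_pow k m : Prop := exists2 U, edge_prod k U & (U <= m)%MM.

Lemma edge_prod_deg k U : edge_prod k U -> mdeg U = k.*2.
Proof.
by elim=> [|k' i j U' _ _ IH]; rewrite ?mdeg0 // !mdegD !mdeg1 IH doubleS.
Qed.

Lemma edge_prodD k l U V :
  edge_prod k U -> edge_prod l V -> edge_prod (k + l) (U + V)%MM.
Proof.
elim=> [|k' i j U' ij _ IH] hV; first by rewrite add0m.
by rewrite -addmA addSn; constructor=> //; apply: IH.
Qed.

Lemma edge_prod1 i j : [set i; j] \in edges G -> edge_prod 1 (U_(i) + U_(j))%MM.
Proof. by move=> ij; rewrite -[(_ + _)%MM]addm0; constructor=> //; constructor. Qed.

Lemma edge_prod_split k U : edge_prod k.+1 U -> exists i j V,
  [/\ [set i; j] \in edges G, edge_prod k V & U = (U_(i) + U_(j) + V)%MM].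
Proof.
by move=> h; inversion h as [|? i j V ij hV]; exists i, j, V.
Qed.

(** The factorization of [U] is reordered so that an edge at [x] comes first; for a single edge the
    remaining factor has degree 0 and cannot contain [x]. *)
Lemma edge_prod_at k U x : edge_prod k.+1 U -> (0 < U x)%N -> exists y V,
  [/\ [set x; y] \in edges G, edge_prod k V & U = (U_(x) + U_(y) + V)%MM].
Proof.
elim: k U => [|k IH] U /edge_prod_split[i [j [V [ij hV ->]]]];
  rewrite !mnmDE !mnm1E;
  have [<- _|ix] := eqVneq i x; try by exists j, V.
all: have [<- _|jx /= Vx] := eqVneq j x;
  first by exists i, V; rewrite setUC [(U_(j) + _)%MM]addmC.
  by have := edge_prod_deg hV; rewrite mdegE (bigD1 x) //=; lia.
have [y [V' [xy hV' ->]]] := IH _ hV Vx.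
exists y, (U_(i) + U_(j) + V')%MM; split=> //; first by constructor.
by apply/mnmP => t; rewrite !mnmDE; lia.
Qed.

Lemma edge_pow_up k m m' : edge_pow k m -> (m <= m')%MM -> edge_pow k m'.
Proof. by case=> U hU le le'; exists U => //; apply: lepm_trans le le'. Qed.

(** A variable x is a vertex of the graph of [m] when U x divides m for some product [U]. All
    vertices witnessed by [U] or by [V] are put in one component, so that paths can be built between
    products instead of variables. *)
Definition prods_linked k m U V : Prop := forall x y,
  (U + U_(x) <= m)%MM -> (V + U_(y) <= m)%MM -> var_linked (edge_pow k) m x y.

(** Distinct x and y witnessed by the same [U] are adjacent, because [U] then divides m / (xy). *)
Lemma prods_linked_refl k m U : edge_prod k U -> prods_linked k m U U.
Proof.
move=> hU x y hx hy; have [->|xy] := eqVneq x y; first exact: rt_refl.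
have h := lep_mnm1D xy hx hy; apply: rt_step; split.
  by apply: (lep_addr_trans (W := U)); rewrite addmC.
by exists U => //; apply: lep_addB.
Qed.

(** The strict degree bound leaves a variable witnessed by [V], where the two paths are joined. *)
Lemma prods_linked_trans k m V U W : edge_prod k V -> (V <= m)%MM ->
  (k.*2 < mdeg m)%N -> prods_linked k m U V -> prods_linked k m V W ->
  prods_linked k m U W.
Proof.
move=> hV le lt hUV hVW x y hx hy.
have [z hz] : exists z, (V + U_(z) <= m)%MM.
  by apply: lep_mdeg => //; rewrite (edge_prod_deg hV).
exact: rt_trans (hUV _ _ hx hz) (hVW _ _ hz hy).
Qed.

(** As m has degree at least 2k + 2, some c satisfies U x c | m. Since U x = V y, this c is
    witnessed by both products. *)
Lemma prods_linked_near k m U V x y : edge_prod k U -> edge_prod k V ->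
  (k.*2.+1 < mdeg m)%N -> (U + U_(x) <= m)%MM ->
  (U + U_(x))%MM = (V + U_(y))%MM -> prods_linked k m U V.
Proof.
move=> hU hV lt hx e a b ha hb.
have [c hc] : exists c, (U + U_(x) + U_(c) <= m)%MM.
  by apply: lep_mdeg => //; rewrite mdegD mdeg1 (edge_prod_deg hU) addn1.
have hcU : (U + U_(c) <= m)%MM.
  apply: (lep_addr_trans (W := U_(x)%MM)).
  by rewrite -addmA [(U_(c) + _)%MM]addmC addmA.
have hcV : (V + U_(c) <= m)%MM.
  apply: (lep_addr_trans (W := U_(y)%MM)).
  by rewrite -addmA [(U_(c) + _)%MM]addmC addmA -e.
exact: rt_trans (prods_linked_refl hU ha hcU) (prods_linked_refl hV hcV hb).
Qed.

(** Multiplication by [W] carries a path in the graph of m / W for k edges to a path in the graph of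
    m for k + l edges. *)
Lemma prods_linkedM k l m U V W : edge_prod l W -> (W <= m)%MM ->
  prods_linked k (m - W) U V -> prods_linked (k + l) m (U + W) (V + W).
Proof.
move=> hW le h x y hx hy.
have hx' : (U + U_(x) <= m - W)%MM.
  by apply: lep_addB; rewrite -addmA [(U_(x) + _)%MM]addmC addmA.
have hy' : (V + U_(y) <= m - W)%MM.
  by apply: lep_addB; rewrite -addmA [(U_(y) + _)%MM]addmC addmA.
move: (h _ _ hx' hy'); apply: var_linked_sub => a b [le1 [T hT leT]].
have le2 : (U_(a) + U_(b) <= m)%MM.
  by apply/mnm_lepP => t; move/mnm_lepP: le1 => /(_ t); rewrite mnmBE; lia.
split=> //; exists (T + W)%MM; first exact: edge_prodD.
apply: lep_addB; apply/mnm_lepP => t.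
move/mnm_lepP: le => /(_ t); move/mnm_lepP: le1 => /(_ t).
by move/mnm_lepP: leT => /(_ t); rewrite !(mnmDE, mnmBE); lia.
Qed.

Lemma edges_linked_share m w y z :
  [set w; y] \in edges G -> [set w; z] \in edges G -> (3 < mdeg m)%N ->
  (U_(w) + U_(y) <= m)%MM -> (U_(w) + U_(z) <= m)%MM ->
  prods_linked 1 m (U_(w) + U_(y)) (U_(w) + U_(z)).
Proof.
move=> wy wz lt hy hz; have [<-|yz] := eqVneq y z.
  exact/prods_linked_refl/edge_prod1.
apply: (@prods_linked_near _ _ _ _ z y) => //; try exact: edge_prod1.
  by rewrite -addmA; apply: lep_mnm1D.
by rewrite -!addmA [(U_(y) + _)%MM]addmC.
Qed.

Lemma edge_pow_min k m : edge_pow k m ->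
  exists2 U, (U <= m)%MM & mdeg U = k.*2 /\ edge_pow k U.
Proof.
case=> U hU le; exists U => //; split; first exact: edge_prod_deg hU.
by exists U; rewrite ?lepm_refl.
Qed.

(** * Degrees in a subset of the variables, and the obstruction caused by a gap *)

Definition set_deg (A : {set 'I_n}) m : nat := \sum_(z in A) m z.

Lemma set_degD A m m' : set_deg A (m + m')%MM = (set_deg A m + set_deg A m')%N.
Proof. by rewrite /set_deg -big_split; apply: eq_bigr => z _; rewrite mnmDE. Qed.

Lemma set_deg1 A x : set_deg A U_(x)%MM = (x \in A).
Proof.
rewrite /set_deg; have [xA|xA] := boolP (x \in A).
  rewrite (bigD1 x) //= mnm1E eqxx big1 // => z /andP[_ zx].
  by rewrite mnm1E eq_sym (negbTE zx).
by rewrite big1 // => z zA; rewrite mnm1E; case: eqP zA xA => // <- ->.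
Qed.

Lemma set_deg_le A m m' : (m <= m')%MM -> (set_deg A m <= set_deg A m')%N.
Proof. by move=> /mnm_lepP h; apply: leq_sum. Qed.

(** Each edge factor lies inside [A] or inside [B] and adds 2 to the degree in that set; a and b
    count the two kinds. *)
Lemma edge_prod_set_deg (A B : {set 'I_n}) k U :
  (forall x y, x \in A -> y \in B -> [set x; y] \notin edges G) ->
  [disjoint A & B] -> edge_prod k U ->
  (forall z, (0 < U z)%N -> z \in A :|: B) ->
  exists a b, [/\ (a + b)%N = k, set_deg A U = a.*2 & set_deg B U = b.*2].
Proof.
move=> noAB dis; elim=> [|l i j V ij hV IH] sub.
  by exists 0%N, 0%N; split=> //; rewrite /set_deg big1 // => z _; rewrite mnm0E.
have /IH[a [b [ab hA hB]]] z : (0 < V z)%N -> z \in A :|: B.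
  by move=> Vz; apply: sub; rewrite !mnmDE; lia.
have iAB : i \in A :|: B by apply: sub; rewrite !mnmDE !mnm1E eqxx.
have jAB : j \in A :|: B by apply: sub; rewrite !mnmDE !mnm1E eqxx; lia.
rewrite !set_degD !set_deg1 hA hB.
have disA z : z \in A -> (z \in B) = false by apply: disjointFr.
case/setUP: iAB jAB => iAB /setUP[] jAB.
- by exists a.+1, b; rewrite !iAB !jAB !disA //; split; lia.
- by case/negP: (noAB _ _ iAB jAB).
- by case/negP: (noAB _ _ jAB iAB); rewrite setUC.
exists a, b.+1; rewrite iAB jAB.
by rewrite !(disjointFl dis) //; split; lia.
Qed.

(* The exponent is the lcm of (ij)^k and (ij)^(k-1) pq. *)
Lemma no_gap_edge_pow k i j p q x y :
  [disjoint [set i; j] & [set p; q]] ->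
  (forall a b, a \in [set i; j] -> b \in [set p; q] ->
     [set a; b] \notin edges G) ->
  x \in [set i; j] -> y \in [set p; q] ->
  let m := ((U_(i) + U_(j)) *+ k + (U_(p) + U_(q)))%MM in
  (U_(x) + U_(y) <= m)%MM -> ~ edge_pow k (m - (U_(x) + U_(y)))%MM.
Proof.
move=> dis noAB xA yB m.
have mE : m = ((U_(i) + U_(j)) *+ k + (U_(p) + U_(q)))%MM by [].
clearbody m => le [U hU leU].
set A := [set i; j] in dis noAB xA; set B := [set p; q] in dis noAB yB.
have degM C V : set_deg C (V *+ k)%MM = (set_deg C V * k)%N.
  rewrite /set_deg big_distrl /=; apply: eq_bigr => z _.
  exact: mulmnE.
have inA z : z \in A -> (z \in B) = false by apply: disjointFr.
have inB z : z \in B -> (z \in A) = false by apply: disjointFl.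
have [iA jA] : i \in A /\ j \in A by rewrite !inE !eqxx orbT.
have [pB qB] : p \in B /\ q \in B by rewrite !inE !eqxx orbT.
have degA : set_deg A m = k.*2.
  by rewrite mE !(set_degD, degM) !set_deg1 iA jA !inB //; lia.
have degB : set_deg B m = 2.
  by rewrite mE !(set_degD, degM) !set_deg1 pB qB !inA //; lia.
have [|a [b [ab hA hB]]] := @edge_prod_set_deg A B k U noAB dis hU.
  move=> z Uz; apply: contraLR (Uz) => zAB.
  move: zAB; rewrite !inE !negb_or -!andbA => /and4P[zi zj zp zq].
  move/mnm_lepP: leU => /(_ z); rewrite -leqNgt => h; apply: leq_trans h _.
  rewrite mnmBE mE !(mnmDE, mulmnE, mnm1E).
  by rewrite ![_ == z]eq_sym !(negbTE zi, negbTE zj, negbTE zp, negbTE zq).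
(* The quotient m / (xy) has degree 2k - 1 in [A] and 1 in [B]. Hence 2a <= 2k - 1 and 2b <= 1, so a
   + b < k. *)
have := set_deg_le A leU; have := set_deg_le B leU.
rewrite hA hB.
move: (congr1 (set_deg A) (submK le)) (congr1 (set_deg B) (submK le)).
rewrite !set_degD !set_deg1 xA yB (inA _ xA) (inB _ yB) degA degB; lia.
Qed.

(** * Linking all products of k edges in a gap free graph *)

Hypothesis gapG : gap_free G.

Lemma edges_linked m e1 e2 f1 f2 :
  [set e1; e2] \in edges G -> [set f1; f2] \in edges G -> (3 < mdeg m)%N ->
  (U_(e1) + U_(e2) <= m)%MM -> (U_(f1) + U_(f2) <= m)%MM ->
  prods_linked 1 m (U_(e1) + U_(e2)) (U_(f1) + U_(f2)).
Proof.
move=> eG fG lt he hf.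
have rep (e a b w : 'I_n) : w \in [set a; b] ->
  exists w', [set a; b] = [set w; w'] /\ (U_(a) + U_(b) = U_(w) + U_(w'))%MM.
  by rewrite !inE => /orP[]/eqP->; [exists b | exists a; rewrite setUC addmC].
have [dis|] := boolP [disjoint [set e1; e2] & [set f1; f2]]; last first.
  rewrite -setI_eq0 => /set0Pn[w]; rewrite inE => /andP[we wf].
  have [y [E1 E2]] := rep e1 _ _ _ we; have [z [F1 F2]] := rep e1 _ _ _ wf.
  by rewrite E2 F2; apply: edges_linked_share; rewrite -?E1 -?F1 -?E2 -?F2.
have [g [gG /set0Pn[p] + /set0Pn[q]]] := gapG eG fG dis.
rewrite !inE -!in_set2 => /andP[pe pg] /andP[qf qg].
have pq : p != q.
  by apply/eqP => pq; move: (disjointFr dis pe); rewrite pq qf.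
(* An edge has at most two vertices, so the edge meeting both sets is {p, q} itself. *)
have gpq : g = [set p; q].
  apply/esym/eqP; rewrite eqEcard cards2 pq (andP (edges_card gG)).2 andbT.
  by apply/subsetP => t; rewrite !inE => /orP[]/eqP->.
have [y [E1 E2]] := rep e1 _ _ _ pe; have [z [F1 F2]] := rep e1 _ _ _ qf.
rewrite gpq in gG.
have leg : (U_(p) + U_(q) <= m)%MM.
  rewrite -[(_ + _)%MM]add0m; apply: lep_mnm1D => //; rewrite add0m.
    by apply: (lep_addr_trans (W := U_(y)%MM)); rewrite -E2.
  by apply: (lep_addr_trans (W := U_(z)%MM)); rewrite -F2.
apply: (@prods_linked_trans _ _ (U_(p) + U_(q))%MM) => //.
- exact: edge_prod1.
- by apply: leq_trans lt.
- by rewrite E2; apply: edges_linked_share; rewrite -?E1 -?E2.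
rewrite F2 addmC; apply: edges_linked_share; rewrite -?F1 -?F2 //.
  by rewrite setUC.
by rewrite addmC.
Qed.

(** The degrees agree, so some x has a larger exponent in [U] than in [V]. An edge xy of [U]
    replaces an edge of [V]: one at y if y divides [V], any edge otherwise. The new product divides
    lcm(U, V). *)
Lemma edge_prod_exchange k m U V : edge_prod k.+1 U -> edge_prod k.+1 V ->
  U != V -> (U <= m)%MM -> (V <= m)%MM -> exists i j U' p q V',
  [/\ [set i; j] \in edges G, edge_prod k U' & U = (U_(i) + U_(j) + U')%MM] /\
  [/\ [set p; q] \in edges G, edge_prod k V', V = (U_(p) + U_(q) + V')%MM &
      (U_(i) + U_(j) + V' <= m)%MM].
Proof.
move=> hU hV UV /mnm_lepP leU /mnm_lepP leV.
have [x ltx] : exists x, (V x < U x)%N.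
  apply/existsP; apply: contraNT UV; rewrite negb_exists => /forallP h.
  have le : (U <= V)%MM by apply/mnm_lepP => t; rewrite leqNgt.
  have := submK le => e; have : mdeg (V - U)%MM == 0%N.
    move: (congr1 (@mdeg n) e).
    by rewrite mdegD (edge_prod_deg hU) (edge_prod_deg hV); lia.
  by rewrite mdeg_eq0 => /eqP e0; rewrite -e e0 add0m.
have [y [U' [xy hU' eU]]] := edge_prod_at hU (leq_ltn_trans (leq0n _) ltx).
exists x, y, U'.
(* If y does not divide [V], its exponent in the new product is its exponent in xy, which is at most
   that in [U], even for a loop x = y. *)
have [Vy|Vy] := posnP (V y).
  have [p [q [V' [pq hV' eV]]]] := edge_prod_split hV.
  exists p, q, V'; do 2!split=> //; apply/mnm_lepP => t.
  move: (leU t) (leV t) ltx Vy; rewrite eU eV !mnmDE !mnm1E.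
  have [<-|yt] := eqVneq y t; first by rewrite eqxx /=; lia.
  by have [xt|_] := eqVneq x t; rewrite ?xt ?eqxx ?(negbTE yt) /=; lia.
(* Replacing yz by xy trades z for x, and x has a larger exponent in [U] than in [V]. *)
have [z [V' [yz hV' eV]]] := edge_prod_at hV Vy.
exists y, z, V'; do 2!split=> //; apply/mnm_lepP => t.
move: (leU t) (leV t) ltx; rewrite eV !mnmDE !mnm1E.
by have [<-|xt] := eqVneq x t; lia.
Qed.

Lemma gap_free_prods_linked k m U V : edge_prod k U -> edge_prod k V ->
  (k.*2.+1 < mdeg m)%N -> (U <= m)%MM -> (V <= m)%MM -> prods_linked k m U V.
Proof.
elim: k m U V => [|k IH] m U V hU hV lt leU leV.
  have h0 W : edge_prod 0 W -> W = 0%MM.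
    by move/edge_prod_deg/eqP; rewrite mdeg_eq0 => /eqP.
  by rewrite (h0 _ hU) (h0 _ hV); apply: prods_linked_refl; constructor.
have [<-|UV] := eqVneq U V; first exact: prods_linked_refl.
have [i [j [U' [p [q [V' [[ij hU' eU] [pq hV' eV leW]]]]]]]] :=
  edge_prod_exchange hU hV UV leU leV.
(* Dividing by l edges lowers the degree of m by 2l, so the bound 2k + 2 passes to the quotient with
   the remaining number of edges. *)
have degB W l : edge_prod l W -> (W <= m)%MM ->
    mdeg (m - W)%MM = (mdeg m - l.*2)%N.
  by move=> hW le; rewrite -{2}(submK le) mdegD (edge_prod_deg hW) addnK.
have hij := edge_prod1 ij; have hpq := edge_prod1 pq.
have leV' : (V' <= m)%MM.
  by apply: (lep_addr_trans (W := (U_(p) + U_(q))%MM)); rewrite addmC -eV.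
have leij : (U_(i) + U_(j) <= m)%MM by apply: lep_addr_trans leW.
apply: (@prods_linked_trans _ _ (U_(i) + U_(j) + V')%MM) => //.
- by constructor.
- by apply: ltn_trans lt.
- rewrite eU addmC [(_ + V')%MM]addmC -addn1.
  apply: (prods_linkedM hij leij); apply: IH => //; last 2 first.
  + by apply: lep_addB; rewrite addmC -eU.
  + by apply: lep_addB; rewrite addmC.
  by rewrite (degB _ _ hij leij); lia.
rewrite eV -add1n; apply: (prods_linkedM hV' leV'); apply: edges_linked => //.
- by rewrite (degB _ _ hV' leV'); lia.
- exact: lep_addB.
- by apply: lep_addB; rewrite -eV.
Qed.

Lemma gap_free_var_linked k m x y : (k.*2.+1 < mdeg m)%N ->
  (0 < m x)%N -> (0 < m y)%N -> edge_pow k (m - U_(x))%MM ->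
  edge_pow k (m - U_(y))%MM -> var_linked (edge_pow k) m x y.
Proof.
move=> lt mx my [U hU leU] [V hV leV].
have up W z : (0 < m z)%N -> (W <= m - U_(z))%MM -> (W + U_(z) <= m)%MM.
  move=> mz /mnm_lepP le; apply/mnm_lepP => t; have := le t.
  by rewrite mnmBE mnmDE mnm1E; case: eqP => [<-|]; lia.
have hx := up _ _ mx leU; have hy := up _ _ my leV.
exact: (gap_free_prods_linked hU hV lt (lep_addr_trans hx) (lep_addr_trans hy)
  hx hy).
Qed.

End EdgeProducts.

(** * Monomial ideals described by their exponents *)

Section MonomialIdeals.
Variables (K : fieldType) (n : nat).
Local Notation S := {mpoly K[n]}.
Implicit Types (P : 'X_{1..n} -> Prop) (f g : S) (m : 'X_{1..n}).
Local Open Scope ring_scope.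

(** For an upward closed [P], this is membership in the monomial ideal whose monomials have
    exponents in [P]. *)
Definition msupp_in P f : Prop := forall m, m \in msupp f -> P m.

Lemma msupp_in0 P : msupp_in P 0.
Proof. by move=> m; rewrite msupp0. Qed.

Lemma msupp_inD P f g : msupp_in P f -> msupp_in P g -> msupp_in P (f + g).
Proof. by move=> hf hg m /msuppD_le; rewrite mem_cat => /orP[/hf|/hg]. Qed.

Lemma msupp_inX P m : msupp_in P 'X_[m] <-> P m.
Proof.
by split=> [|Pm m']; [apply; rewrite msuppX inE | rewrite msuppX inE => /eqP->].
Qed.

(** Upward closure makes the polynomials supported in [P] an ideal, so the generators suffice. *)
Lemma ideal_gen_msupp_in P (A : S -> Prop) f :
  (forall m m', P m -> (m <= m')%MM -> P m') ->
  (forall g, A g -> msupp_in P g) -> ideal_gen A f -> msupp_in P f.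
Proof.
move=> up hA [s [hs ->]]; rewrite big_seq.
elim/big_ind: _ => [||p /hs/hA hp m]; [exact: msupp_in0|exact: msupp_inD|].
move/msuppM_le/allpairsP=> [[m1 m2] /= [_ /hp Pm ->]].
by apply: up Pm _; apply: lem_addl.
Qed.

Lemma msupp_in_ideal_gen P (A : S -> Prop) f :
  (forall m, P m -> exists2 m', (m' <= m)%MM & A 'X_[m']) ->
  msupp_in P f -> ideal_gen A f.
Proof.
(* Each term of [f] is a multiple of a generator; outside the support the cofactor 0 is a dummy
   value. *)
move=> PA Pf; have h m : exists c, m \in msupp f ->
    exists2 m', A 'X_[m'] & 'X_[m] = c * 'X_[m'] :> S.
  have [/Pf/PA[m' le Am']|_] := boolP (m \in msupp f); last by exists 0.
  by exists 'X_[(m - m')%MM] => _; exists m'; rewrite // -mpolyXD submK.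
suff: forall s : seq 'X_{1..n}, {subset s <= msupp f} ->
    ideal_gen A (\sum_(m <- s) f@_m *: 'X_[m]).
  by move/(_ _ (fun=> id)); rewrite -mpolyE.
elim=> [|m s IH] sub; first by exists [::]; split=> //; rewrite !big_nil.
have /IH[t [tA te]] : {subset s <= msupp f}.
  by move=> m' m's; apply: sub; rewrite inE m's orbT.
have [c /(_ (sub _ (mem_head _ _)))[m' Am' e]] := h m.
exists ((f@_m *: c, 'X_[m']) :: t); split.
  by move=> q; rewrite inE => /orP[/eqP->|/tA].
by rewrite !big_cons te /= e scalerAl.
Qed.

Lemma edge_idealP (G : loopgraph n) k f :
  ideal_pow (edge_ideal K G) k f <-> msupp_in (edge_pow G k) f.
Proof.
have up k' m m' : edge_pow G k' m -> (m <= m')%MM -> edge_pow G k' m'.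
  exact: edge_pow_up.
elim: k f => [|k IH] f.
  split=> // _ m _; exists 0%MM; first exact: edge_prod0.
  by apply/mnm_lepP => i; rewrite mnm0E.
split; apply: (ideal_gen_msupp_in (up _)) || apply: msupp_in_ideal_gen.
  move=> _ [a [b [Ia /IH hb ->]]] m.
  move=> /msuppM_le/allpairsP[[m1 m2] /= [h1 /hb h2 ->]].
  (* An element of I(G) need not be a monomial; divisibility by an edge is first shown on its whole
     support. *)
  pose Q m := exists i j, [set i; j] \in edges G /\ (U_(i) + U_(j) <= m)%MM.
  have /(_ _ h1)[i [j [ij le]]] : msupp_in Q a.
    apply: ideal_gen_msupp_in Ia => [m' m'' [i [j [ij le]]] le'|].
      by exists i, j; split=> //; apply: lepm_trans le le'.
    move=> _ [i [j [ij ->]]]; rewrite -mpolyXD; apply/msupp_inX.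
    by exists i, j; rewrite lepm_refl.
  case: h2 => U hU leU; exists (U_(i) + U_(j) + U)%MM; first by constructor.
  move/mnm_lepP: le => le; move/mnm_lepP: leU => leU.
  by apply/mnm_lepP => t; have := le t; have := leU t; rewrite !mnmDE; lia.
move=> m [U /edge_prod_split[i [j [V [ij hV ->]]]] le].
exists (U_(i) + U_(j) + V)%MM => //.
exists ('X_i * 'X_j), 'X_[V]; split; last by rewrite !mpolyXD.
  exists [:: (1, 'X_i * 'X_j)]; split; last by rewrite big_seq1 mul1r.
  by move=> p; rewrite inE => /eqP->; exists i, j.
by apply/IH/msupp_inX; exists V; rewrite // lepm_refl.
Qed.

End MonomialIdeals.

(** * Suprema and vanishing of quotient dimensions *)

Lemma enat_sup0 (Q : nat -> Prop) :
  enat_sup Q = Fin 0 <-> (exists s, is_lub Q s) /\ forall r, Q r -> r = 0%N.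
Proof.
rewrite /enat_sup; case: excluded_middle_informative => [h|h].
  case: constructive_indefinite_description => s /= hs; split.
    case=> s0; split=> // r /hs.1; rewrite s0; lia.
  move=> [_ Q0]; congr Fin; apply/eqP; rewrite -leqn0; apply: hs.2 => r /Q0 ->.
  by [].
by split=> // -[].
Qed.

(** Without a least upper bound the supremum is [Inf], and a positive element exists, since
    otherwise 0 would be a least upper bound. *)
Lemma enat_lt1_succ_sup (Q : nat -> Prop) :
  enat_lt (Fin 1) (enat_succ (enat_sup Q)) <-> exists2 r, Q r & (0 < r)%N.
Proof.
rewrite /enat_sup; case: excluded_middle_informative => [h|h].
  case: constructive_indefinite_description => s /= hs; split; last first.
    by case=> r /hs.1; lia.
  move=> s1; apply: NNPP => no; have : (s <= 0)%N; last lia.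
  by apply: hs.2 => r Qr; rewrite leqNgt; apply/negP => r0; apply: no; exists r.
split=> // _; apply: NNPP => no; apply: h; exists 0%N; split=> // r Qr.
by rewrite leqNgt; apply/negP => r0; apply: no; exists r.
Qed.

Section QuotDim.
Variables (K : fieldType) (V : lmodType K) (Z B : V -> Prop).
Local Open Scope ring_scope.

(** A vector of [Z] outside [B] is by itself independent modulo [B], as scaling by an inverse shows;
    conversely, an independent family has no member in [B]. *)
Lemma quot_dim0 : (forall a v, B v -> B (a *: v)) ->
  quot_dim Z B = Fin 0 <-> forall v, Z v -> B v.
Proof.
move=> BZ; rewrite /quot_dim enat_sup0; split=> [[_ h] v Zv|ZB].
  apply: NNPP => Bv; suff: 1%N = 0%N by [].
  apply: h; exists (fun=> v); split=> // a; rewrite big_ord1 => Ba l.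
  rewrite (ord1 l); apply/eqP; apply: contraT => a0; case: Bv.
  by rewrite -[v](scalerK a0); apply: BZ.
have z r : (exists w : 'I_r -> V, (forall l, Z (w l)) /\ indep_mod B w) -> r = 0%N.
  case: r => [//|r] [w [/(_ ord0)/ZB Bw]].
  move=> /(_ (fun l => (l == ord0)%:R)) /(_ _ ord0).
  rewrite (bigD1 ord0) //= scale1r big1 ?addr0 => [/(_ Bw)/eqP|l /negbTE->].
    by rewrite oner_eq0.
  exact: scale0r.
split=> //; exists 0%N; split=> [r /z -> //|t _]; exact: leq0n.
Qed.

End QuotDim.

(** * Chains and boundaries with coefficients in a monomial ideal *)

Section Boundaries.
Variables (K : fieldType) (n : nat) (F : free_resolution K n).
Local Notation S := {mpoly K[n]}.
Variable P : 'X_{1..n} -> Prop.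
Variable J : S -> Prop.
Hypothesis JP : forall f, J f <-> msupp_in P f.
Local Open Scope ring_scope.

(** Membership in a monomial ideal and homogeneity are both conditions on single monomials. *)
Lemma tensor_chainP i j (v : {ffun res_basis F i -> S}) :
  tensor_chain J j v <->
  forall b m, m \in msupp (v b) -> P m /\ (res_deg b + mdeg m)%N = j.
Proof.
split=> [h b m hm|h b].
  have [/JP Jv /allP/(_ _ hm)/eqP e] := h b; split=> //; exact: Jv.
split; first by apply/JP => m /h[].
by apply/allP => m /h[_ /eqP].
Qed.

Variables i j : nat.
Implicit Types v : {ffun res_basis F i -> S}.

Lemma tensor_boundary0 : tensor_boundary J j (0 : {ffun res_basis F i -> S}).
Proof.
exists 0; split; first by apply/tensor_chainP => b m; rewrite ffunE msupp0.
by apply/ffunP => c; rewrite !ffunE big1 // => b _; rewrite ffunE mul0r.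
Qed.

Lemma tensor_boundaryZ a v : tensor_boundary J j v -> tensor_boundary J j (a *: v).
Proof.
case=> u [/tensor_chainP uJ ->]; exists (a *: u); split.
  by apply/tensor_chainP => b m; rewrite ffunE => /msuppZ_le/uJ.
apply/ffunP => c; rewrite !ffunE scaler_sumr; apply: eq_bigr => b _.
by rewrite ffunE scalerAl.
Qed.

Lemma tensor_boundaryD v w : tensor_boundary J j v -> tensor_boundary J j w ->
  tensor_boundary J j (v + w).
Proof.
case=> u [/tensor_chainP uJ ->] [u' [/tensor_chainP uJ' ->]].
exists (u + u'); split.
  apply/tensor_chainP => b m; rewrite ffunE => /msuppD_le.
  by rewrite mem_cat => /orP[/uJ|/uJ'].
apply/ffunP => c; rewrite !ffunE -big_split; apply: eq_bigr => b _.
by rewrite ffunE mulrDl.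
Qed.

Lemma tensor_boundary_sum (I : eqType) (r : seq I)
    (f : I -> {ffun res_basis F i -> S}) :
  (forall t, t \in r -> tensor_boundary J j (f t)) ->
  tensor_boundary J j (\sum_(t <- r) f t).
Proof.
move=> h; rewrite big_seq; elim/big_ind: _ => //.
  exact: tensor_boundary0.
exact: tensor_boundaryD.
Qed.

Lemma tor_dim0 : tor_dim F J i j = Fin 0 <->
  forall v, tensor_cycle J j v -> tensor_boundary J j v.
Proof. by apply: quot_dim0 => a v; apply: tensor_boundaryZ. Qed.

End Boundaries.

(** * Vanishing of Tor_0 and Tor_1 through the Koszul complex *)

Section KoszulCriterion.
Variables (K : fieldType) (n : nat).
Local Notation S := {mpoly K[n]}.
Variable P : 'X_{1..n} -> Prop.
Variable J : S -> Prop.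
Hypothesis JP : forall f, J f <-> msupp_in P f.
Local Open Scope ring_scope.
Implicit Types (m : 'X_{1..n}) (x y : 'I_n).
Local Notation chain := (@tensor_chain K n (koszul K n) J).
Local Notation boundary := (@tensor_boundary K n (koszul K n) J).

Definition koszul1 x : koszul_basis n 1 := Sub [set x] (introT eqP (cards1 x)).

Lemma koszul1P (b : koszul_basis n 1) : exists x, b = koszul1 x.
Proof. by have /cards1P[x e] := valP b; exists x; apply: val_inj. Qed.

(** The 1-chain (m / x) e_x, which stands for the vertex x of the graph of [m]. *)
Definition mono_chain m x : {ffun koszul_basis n 1 -> S} :=
  [ffun b => if val b == [set x] then 'X_[(m - U_(x))%MM] else 0].

Lemma mono_chainE m x y :
  mono_chain m x (koszul1 y) = if y == x then 'X_[(m - U_(x))%MM] else 0.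
Proof. by rewrite ffunE (inj_eq set1_inj). Qed.

Lemma mono_chainMX m x : (0 < m x)%N ->
  mono_chain m x (koszul1 x) * 'X_x = 'X_[m].
Proof. by move=> mx; rewrite mono_chainE eqxx -mpolyXD submK // lep1mP -lt0n. Qed.

Lemma koszul_diff0E (v : {ffun koszul_basis n 1 -> S}) c :
  free_map (@koszul_diff K n 0) v c = \sum_x v (koszul1 x) * 'X_x.
Proof.
have /eqP := valP c; rewrite kD_val => /cards0_eq ->.
rewrite /kD; apply: eq_big => [x|x _]; first by rewrite inE.
rewrite (_ : [set _ in _ | _] = set0) ?cards0 ?scale1r; last first.
  by apply/setP => y; rewrite !inE.
by rewrite setU0 -[X in kext v X]/(val (koszul1 x)) kext_val.
Qed.

Lemma mono_chain_diff m x c : (0 < m x)%N ->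
  free_map (@koszul_diff K n 0) (mono_chain m x) c = 'X_[m].
Proof.
move=> mx; rewrite koszul_diff0E (bigD1 x) //= mono_chainMX // big1 ?addr0 //.
by move=> y /negbTE yx; rewrite mono_chainE yx mul0r.
Qed.

Lemma mono_chain_in m x : (0 < m x)%N -> P (m - U_(x))%MM ->
  chain (i := 1) (mdeg m) (mono_chain m x).
Proof.
move=> mx Pm; apply/(tensor_chainP JP) => b m'; rewrite ffunE.
case: eqP => _; last by rewrite msupp0.
rewrite msuppX inE => /eqP->; split=> //=.
have /(congr1 (@mdeg n)) : (m - U_(x) + U_(x) = m)%MM.
  by rewrite submK // lep1mP -lt0n.
by rewrite mdegD mdeg1 => <-; rewrite addnC.
Qed.

(** The 2-chain (m / (xy)) e_{x,y} stands for the edge xy. Since x < y, removing x has sign + and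
    leaves e_y, and removing y has sign -. *)
Lemma koszul_diff1E m x y (xy : (x < y)%N) (hb : #|[set x; y]| == 2) :
  (U_(x) + U_(y) <= m)%MM ->
  free_map (@koszul_diff K n 1)
    [ffun b : koszul_basis n 2 =>
       if val b == [set x; y] then 'X_[(m - (U_(x) + U_(y)))%MM] else 0]
  = mono_chain m y - mono_chain m x.
Proof.
move=> le; have nxy : x != y by rewrite -val_eqE /= ltn_eqF.
apply/ffunP => c; rewrite !ffunE (bigD1 (Sub [set x; y] hb)) //= [X in _ + X]big1.
  rewrite addr0 ffunE eqxx /koszul_diff big_mkcondr big_setU1 ?inE //= big_set1.
  rewrite setU1K ?inE // [ [set x; y] ]setUC setU1K ?inE 1?eq_sym //.
  rewrite (_ : [set z in _ | _] = set0) ?cards0; last first.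
    apply/setP => z; rewrite !inE.
    by case: eqP => [->|_]; last case: eqP => [->|//]; lia.
  rewrite (_ : [set z in _ | _] = [set x]) ?cards1; last first.
    apply/setP => z; rewrite !inE orbC; case: eqP => [->|_]; first by rewrite xy.
    by case: eqP => [->|//]; rewrite ltnn.
  have eX : (m - (U_(x) + U_(y)) + U_(x) = m - U_(y))%MM.
    apply/mnmP => t; move/mnm_lepP: le => /(_ t).
    by rewrite !(mnmDE, mnmBE); lia.
  have eY : (m - (U_(x) + U_(y)) + U_(y) = m - U_(x))%MM.
    apply/mnmP => t; move/mnm_lepP: le => /(_ t).
    by rewrite !(mnmDE, mnmBE); lia.
  rewrite expr0 expr1 scale1r scaleN1r mulrDr.
  congr (_ + _); first by case: eqP; rewrite ?mulr0 // -mpolyXD eX.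
  by case: eqP; rewrite ?mulr0 ?oppr0 // mulrN -mpolyXD eY.
move=> b hbb; rewrite ffunE; case: eqP => [e|_]; last by rewrite mul0r.
by case/eqP: hbb; apply: val_inj.
Qed.

Lemma boundary_adj m x y : var_adj P m x y ->
  boundary (i := 1) (mdeg m) (mono_chain m x - mono_chain m y).
Proof.
(* The order x < y fixes the signs of the differential; exchanging x and y negates the chain, and x
   = y gives 0. *)
wlog xy : x y / (x < y)%N => [hw|] [le Pm].
  have [xy|yx|/val_inj <-] := ltngtP x y.
  - exact: hw.
  - rewrite -opprB -scaleN1r; apply: (tensor_boundaryZ JP); apply: hw => //.
    by split; rewrite addmC.
  - by rewrite subrr; apply: (tensor_boundary0 _ JP).
have nxy : x != y by rewrite -val_eqE /= ltn_eqF.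
have hb : #|[set x; y]| == 2 by rewrite cards2 nxy.
rewrite -opprB -scaleN1r -(koszul_diff1E xy hb) //; apply: (tensor_boundaryZ JP).
eexists; split; last by [].
apply/(tensor_chainP JP) => b m'; rewrite ffunE.
case: eqP => _; last by rewrite msupp0.
rewrite msuppX inE => /eqP->; split=> //=.
move/(congr1 (@mdeg n)): (submK le).
by rewrite !mdegD !mdeg1 => <-; rewrite addnC.
Qed.

Lemma boundary_linked m x y : var_linked P m x y ->
  boundary (i := 1) (mdeg m) (mono_chain m x - mono_chain m y).
Proof.
elim=> {x y} [x y|x|x y z _ h1 _ h2]; first exact: boundary_adj.
  by rewrite subrr; apply: (tensor_boundary0 _ JP).
by rewrite -(subrKA (mono_chain m y)); apply: (tensor_boundaryD JP).
Qed.

(** Decomposition by multidegree. The coefficient is taken after multiplication by ['X_x], so it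
    vanishes when x does not divide m, where [m - U_(x)] is truncated; summed over x it is the
    coefficient of m in the differential. *)
Lemma mono_chain_decomp (v : {ffun koszul_basis n 1 -> S}) :
  exists2 L : seq 'X_{1..n},
    (forall m, m \in L ->
       exists x m', m' \in msupp (v (koszul1 x)) /\ m = (m' + U_(x))%MM) &
    v = \sum_(m <- L) \sum_x (v (koszul1 x) * 'X_x)@_m *: mono_chain m x.
Proof.
pose L := undup (flatten [seq [seq (m' + U_(x))%MM | m' <- msupp (v (koszul1 x))]
                         | x <- enum 'I_n]).
have LP m : reflect
    (exists x m', m' \in msupp (v (koszul1 x)) /\ m = (m' + U_(x))%MM) (m \in L).
  rewrite mem_undup; apply: (iffP flattenP) => [[s /mapP[x _ ->] /mapP[m' h ->]]|].
    by exists x, m'.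
  move=> [x [m' [h ->]]].
  exists [seq (m' + U_(x))%MM | m' <- msupp (v (koszul1 x))].
    by apply: map_f; rewrite mem_enum.
  exact: map_f.
exists L; first by move=> m /LP.
apply/ffunP => b; have [y ->] := koszul1P b; rewrite sum_ffunE.
apply/mpolyP => m0; rewrite raddf_sum /=.
under eq_bigr => m _.
  rewrite sum_ffunE (bigD1 y) //= ffunE mono_chainE eqxx big1 ?addr0; last first.
    by move=> x xy; rewrite ffunE mono_chainE eq_sym (negbTE xy) scaler0.
  rewrite mcoeffZ mcoeffX mcoeffMXU; over.
(* Only the multidegree m0 + y contributes to the coefficient of m0 at e_y. *)
have [inL|ninL] := boolP ((m0 + U_(y))%MM \in L).
  rewrite (bigD1_seq _ inL) ?undup_uniq //= mnmDE mnm1E eqxx addn1 /= addmK eqxx.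
  rewrite mulr1 big1 ?addr0 // => m ne; case: ltnP => my; last by rewrite mul0r.
  case: eqP => [e|_]; last by rewrite mulr0.
  by case/eqP: ne; rewrite -e submK // lep1mP -lt0n.
rewrite big_seq big1 => [|m mL].
  apply: memN_msupp_eq0; apply: contra ninL => h; apply/LP.
  by exists y, m0.
case: ltnP => my; last by rewrite mul0r.
case: eqP => [e|_]; last by rewrite mulr0.
by case/negP: ninL; rewrite -e submK // lep1mP -lt0n.
Qed.

(** In each multidegree the coefficients of a cycle sum to 0, so it is a combination of differences
    (m / x) e_x - (m / r) e_r with r fixed, and a path from x to r makes each of them a boundary. *)
Lemma betti1_eq0 t :
  (forall m x y, mdeg m = t -> (0 < m x)%N -> (0 < m y)%N ->
     P (m - U_(x))%MM -> P (m - U_(y))%MM -> var_linked P m x y) ->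
  betti J 1 t = Fin 0.
Proof.
move=> link; apply/(tor_dim0 _ JP) => v [/(tensor_chainP JP) vJ dv].
have [L hL ->] := mono_chain_decomp v.
apply: (tensor_boundary_sum JP) => m /hL[x0 [m' [h0 em]]].
have [_ /= d0] := vJ _ _ h0.
have mt : mdeg m = t by rewrite em mdegD mdeg1 addnC.
pose c x := (v (koszul1 x) * 'X_x)@_m; rewrite -/(c _).
have c_sum : \sum_x c x = 0.
  have h : #|set0 : {set 'I_n}| == 0%N by rewrite cards0.
  move/ffunP/(_ (Sub set0 h)): dv; rewrite koszul_diff0E ffunE.
  by move/(congr1 (mcoeff m)); rewrite mcoeff0 raddf_sum.
(* A nonzero coefficient makes x a vertex of the graph of m, because the chain has its entries in
   J. *)
have cP x : c x != 0 -> (0 < m x)%N /\ P (m - U_(x))%MM.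
  rewrite /c mcoeffMXU; case: ltnP; rewrite ?eqxx // => mx.
  by rewrite -mcoeff_msupp => /vJ[].
have [/existsP[r cr]|] := boolP [exists r, c r != 0]; last first.
  rewrite negb_exists => /forallP c0.
  rewrite big1; first exact: (tensor_boundary0 _ JP).
  move=> x _; move: (c0 x); rewrite negbK => /eqP; rewrite -/(c x) => ->.
  exact: scale0r.
have -> : \sum_x c x *: mono_chain m x =
    \sum_x c x *: (mono_chain m x - mono_chain m r).
  under [RHS]eq_bigr do rewrite scalerBr.
  by rewrite sumrB -scaler_suml c_sum scale0r subr0.
apply: (tensor_boundary_sum JP) => x _.
have [->|cx] := eqVneq (c x) 0.
  by rewrite scale0r; apply: (tensor_boundary0 _ JP).
apply: (tensor_boundaryZ JP); rewrite -mt; apply: boundary_linked.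
have [mx Px] := cP _ cx; have [mr Pr] := cP _ cr; exact: link.
Qed.

(** A monomial m with m / x in J is the differential of (m / x) e_x. *)
Lemma betti0_eq0 t :
  (forall m, mdeg m = t -> P m -> exists2 x, (0 < m x)%N & P (m - U_(x))%MM) ->
  betti J 0 t = Fin 0.
Proof.
move=> red; apply/(tor_dim0 _ JP) => v /(tensor_chainP JP) vJ.
have h : #|set0 : {set 'I_n}| == 0%N by rewrite cards0.
pose b0 : koszul_basis n 0 := Sub set0 h.
have -> : v = \sum_(m <- msupp (v b0)) (v b0)@_m *: [ffun => 'X_[m]].
  apply/ffunP => b; rewrite sum_ffunE.
  have -> : b = b0 by apply: val_inj; apply: cards0_eq; apply/eqP; apply: (valP b).
  by rewrite {1}[v b0]mpolyE; apply: eq_bigr => m _; rewrite !ffunE.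
apply: (tensor_boundary_sum JP) => m /vJ[Pm /= mt]; apply: (tensor_boundaryZ JP).
have [x mx Px] := red m mt Pm; exists (mono_chain m x); split.
  by rewrite -mt; apply: mono_chain_in.
by apply/ffunP => c; rewrite mono_chain_diff // ffunE.
Qed.

Lemma kext_msupp (i t : nat) (u : {ffun koszul_basis n i -> S}) T m :
  chain (i := i) t u -> m \in msupp (kext u T) -> P m.
Proof.
move/(tensor_chainP JP) => uJ; have [hT|hT] := boolP (#|T| == i).
  by rewrite -[T]/(val (Sub T hT : koszul_basis n i)) kext_val => /uJ[].
by rewrite kext_out // msupp0.
Qed.

(* Restricting a 2-chain to the basis elements inside A and applying the      *)
(* differential twice gives 0; in degree m this is the A-part of the boundary. *)
Lemma boundary_cut (A : {set 'I_n}) m t (v : {ffun koszul_basis n 1 -> S}) :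
  (forall x y, x \in A -> y \notin A -> (U_(x) + U_(y) <= m)%MM ->
     ~ P (m - (U_(x) + U_(y)))%MM) ->
  boundary (i := 1) t v -> \sum_(x in A) (v (koszul1 x) * 'X_x)@_m = 0.
Proof.
move=> cut [u [uJ ->]].
pose g (T : {set 'I_n}) := if T \subset A then kext u T else 0.
transitivity (kD (kD g) set0)@_m; last by rewrite kDD mcoeff0.
rewrite {1}/kD raddf_sum /= big_mkcond [RHS]big_mkcond; apply: eq_bigr => x _.
rewrite inE setU0 (_ : [set _ in _ | _] = set0) ?cards0 ?scale1r; last first.
  by apply/setP => y; rewrite !inE.
rewrite kD_val /kD !mulr_suml !raddf_sum /=.
(* For x in [A], the terms with y outside [A] have coefficient 0 at m by the cut; for x outside [A],
   the restriction kills every term. *)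
case: ifP => xA.
  apply: eq_bigr => y; rewrite inE => yx.
  rewrite /g subUset !sub1set xA andbT; case: ifP => // /negbT yA.
  rewrite mul0r scaler0 mul0r mcoeff0 -scalerAl mcoeffZ -mulrA -mpolyXD.
  rewrite memN_msupp_eq0 ?mulr0 //; apply/negP.
  rewrite (perm_mem (msuppMX _ _)) => /mapP[m' /(kext_msupp uJ) Pm' em].
  apply: (cut x y xA yA).
    by rewrite em addmC; apply: lem_addr.
  by rewrite em [(_ + m')%MM]addmC [(U_(x) + _)%MM]addmC addmK.
rewrite big1 // => y _; rewrite /g subUset !sub1set xA andbF.
by rewrite mul0r scaler0 mul0r mcoeff0.
Qed.

(** The cycle (m / a) e_a - (m / b) e_b has an [A]-part with coefficient 1 at m, whereas
    [boundary_cut] gives 0 for boundaries. *)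
Lemma betti1_neq0 (A : {set 'I_n}) m a b :
  (forall x y, x \in A -> y \notin A -> (U_(x) + U_(y) <= m)%MM ->
     ~ P (m - (U_(x) + U_(y)))%MM) ->
  a \in A -> b \notin A -> (0 < m a)%N -> (0 < m b)%N ->
  P (m - U_(a))%MM -> P (m - U_(b))%MM -> betti J 1 (mdeg m) <> Fin 0.
Proof.
move=> cut aA bA ma mb Pa Pb /(tor_dim0 _ JP).
move/(_ (mono_chain m a - mono_chain m b)); case.
  split.
    apply/(tensor_chainP JP) => c m'.
    move: (mono_chain_in ma Pa) (mono_chain_in mb Pb).
    move=> /(tensor_chainP JP)/(_ c m') + /(tensor_chainP JP)/(_ c m').
    by rewrite !ffunE => ha hb /msuppB_le; rewrite mem_cat => /orP[/ha|/hb].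
  apply/ffunP => c; rewrite koszul_diff0E ffunE.
  transitivity (free_map (@koszul_diff K n 0) (mono_chain m a) c -
                free_map (@koszul_diff K n 0) (mono_chain m b) c).
    rewrite !koszul_diff0E -sumrB.
    by apply: eq_bigr => x _; rewrite !ffunE mulrBl.
  by rewrite !mono_chain_diff // subrr.
move=> u hu; have := boundary_cut cut (ex_intro _ u hu).
have coefE x : ((mono_chain m a - mono_chain m b) (koszul1 x) * 'X_x)@_m =
    (mono_chain m a (koszul1 x) * 'X_x)@_m -
    (mono_chain m b (koszul1 x) * 'X_x)@_m.
  by rewrite !ffunE mulrBl mcoeffB.
rewrite (bigD1 a) //= big1 ?addr0 => [|x /andP[xA xa]]; rewrite coefE.
  have ab : a != b by apply: contraNneq bA => <-.
  rewrite mono_chainMX // mcoeffX eqxx mono_chainE (negbTE ab) mul0r mcoeff0 subr0.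
  by move/eqP; rewrite oner_eq0.
have xb : x != b by apply: contraNneq bA => <-.
by rewrite !mono_chainE (negbTE xa) (negbTE xb) mul0r mcoeff0 subr0.
Qed.

End KoszulCriterion.

(** * The index of powers of edge ideals *)

Section PowersOfEdgeIdeals.
Variables (K : fieldType) (n : nat) (G : loopgraph n).

Lemma edge_ideal_pow_generated k :
  generated_in_degree (ideal_pow (edge_ideal K G) k) k.*2.
Proof.
exists (fun f => exists2 m, f = 'X_[m] & mdeg m = k.*2 /\ edge_pow G k m).
split=> [_ [m -> [mk _]]|f].
  by apply/dhomogP => m'; rewrite msuppX inE => /eqP->.
rewrite edge_idealP; split.
  apply: msupp_in_ideal_gen => m /edge_pow_min[U le [dU hU]].
  by exists U => //; exists U.
apply: ideal_gen_msupp_in; first by move=> m m'; apply: edge_pow_up.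
by move=> _ [m -> [_ hm]]; apply/msupp_inX.
Qed.

(** The degree d in [steps_linear] is existentially quantified; a monomial of J bounds it from
    above. *)
Lemma generated_in_degree_le (J : {mpoly K[n]} -> Prop) d m :
  generated_in_degree J d -> J 'X_[m] -> (d <= mdeg m)%N.
Proof.
case=> A [homA genA] /genA JX.
apply/(@msupp_inX K n (fun m => d <= mdeg m)%N).
apply: ideal_gen_msupp_in JX => [m1 m2 le1 le|g /homA/dhomogP hg m' /hg <- //].
by apply: leq_trans le1 _; rewrite -(submK le) mdegD leq_addl.
Qed.

Lemma ideal_index_gt1 (J : {mpoly K[n]} -> Prop) :
  enat_lt (Fin 1) (ideal_index J) <->
  (forall f, J f -> f = 0%R) \/ exists2 r, steps_linear J r & (0 < r)%N.
Proof.
rewrite /ideal_index; case: excluded_middle_informative => h.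
  by split=> // _; left.
by rewrite enat_lt1_succ_sup; split=> [|[]//]; right.
Qed.

Lemma gap_free_index k : gap_free G ->
  enat_lt (Fin 1) (ideal_index (ideal_pow (edge_ideal K G) k)).
Proof.
move=> gapG; apply/ideal_index_gt1; right; exists 1%N => //.
exists k.*2; split; first exact: edge_ideal_pow_generated.
(* For i = 0, a monomial of degree j > 2k in the ideal is a proper multiple of a product of k edges;
   for i = 1, the degree 1 + j is at least 2k + 2, as linking requires. *)
have JP := @edge_idealP K n G k; case=> [|[|//]] j _ kj.
  apply: (betti0_eq0 JP) => m mj [U hU leU].
  have [|x hx] := lep_mdeg leU; first by rewrite (edge_prod_deg hU) mj.
  exists x; last by exists U => //; apply: lep_addB.
  by move/mnm_lepP/(_ x): hx; rewrite mnmDE mnm1E eqxx; lia.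
apply: (betti1_eq0 JP) => m x y mj mx my hx hy.
by apply: gap_free_var_linked => //; rewrite mj add1n ltnS.
Qed.

Lemma index_gap_free k : (0 < k)%N ->
  enat_lt (Fin 1) (ideal_index (ideal_pow (edge_ideal K G) k)) -> gap_free G.
Proof.
case: k => [//|k] _ /ideal_index_gt1 idx e e' eG e'G dis; apply: NNPP => noF.
have JP := @edge_idealP K n G k.+1.
have pairP f : f \in edges G -> exists i j, f = [set i; j].
  move/edges_card/andP=> [f1 f2]; have : #|f| = 1%N \/ #|f| = 2 by lia.
  case=> [/eqP/cards1P[i ->]|/eqP/cards2P[i [j [_ ->]]]]; last by exists i, j.
  by exists i, i; rewrite setUid.
have [i [j eE]] := pairP _ eG; have [p [q e'E]] := pairP _ e'G.
rewrite {}eE {}e'E in eG e'G dis noF.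
have noAB a b : a \in [set i; j] -> b \in [set p; q] ->
    [set a; b] \notin edges G.
  move=> ha hb; apply/negP => abG; apply: noF; exists [set a; b]; split=> //.
    by apply/set0Pn; exists a; rewrite in_setI ha !inE eqxx.
  by apply/set0Pn; exists b; rewrite in_setI hb !inE eqxx orbT.
have prod l : edge_prod G l ((U_(i) + U_(j)) *+ l)%MM.
  elim: l => [|l IH]; first by rewrite mulm0n; constructor.
  by rewrite mulmS; constructor.
(* From here on the power is k + 1; both (ij)^(k+1) and (ij)^k pq divide [m]. *)
pose m := ((U_(i) + U_(j)) *+ k.+1 + (U_(p) + U_(q)))%MM.
have degk l : mdeg ((U_(i) + U_(j)) *+ l)%MM = l.*2.
  exact: edge_prod_deg (prod l).
have degm : mdeg m = k.+1.*2.+2 by rewrite !mdegD degk !mdeg1 addn2.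
have JX : ideal_pow (edge_ideal K G) k.+1 'X_[(U_(i) + U_(j)) *+ k.+1].
  by apply/JP/msupp_inX; exists ((U_(i) + U_(j)) *+ k.+1)%MM; rewrite ?lepm_refl.
(* The ideal is not zero, since it contains (ij)^(k+1). *)
case: idx => [/(_ _ JX)/eqP|[r [d [genJ lin]] r0]].
  by rewrite -msupp_eq0 msuppX.
have dk : (d <= k.+1.*2)%N by rewrite -degk; apply: generated_in_degree_le genJ JX.
suff: betti (ideal_pow (edge_ideal K G) k.+1) 1 (mdeg m) <> Fin 0.
  (* The degree of m is 1 + j with j = 2(k + 1) + 1 > d, so linearity at homological degree 1 gives
     vanishing. *)
  by rewrite degm -add1n; apply; apply: lin; lia.
have outA z : z \in [set p; q] -> z \notin [set i; j].
  by move=> zB; rewrite (disjointFl dis zB).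
have cut x y : x \in [set i; j] -> y \notin [set i; j] ->
    (U_(x) + U_(y) <= m)%MM -> ~ edge_pow G k.+1 (m - (U_(x) + U_(y)))%MM.
  (* A variable of m outside {i, j} lies in {p, q}. *)
  move=> xA yA le; apply: (no_gap_edge_pow dis noAB xA _ le).
  have : (0 < m y)%N by move/mnm_lepP/(_ y): le; rewrite mnmDE !mnm1E eqxx; lia.
  move: yA; rewrite !inE negb_or /m !(mnmDE, mulmnE, mnm1E) ![_ == y]eq_sym.
  by move=> /andP[/negbTE-> /negbTE->]; case: eqP => //; case: eqP.
apply: (betti1_neq0 JP (A := [set i; j]) (a := i) (b := p) cut).
- by rewrite !inE eqxx.
- by apply: outA; rewrite !inE eqxx.
- by rewrite /m !(mnmDE, mulmnE, mnm1E) eqxx; lia.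
- by rewrite /m !(mnmDE, mulmnE, mnm1E) eqxx; lia.
(* (ij)^k pq divides m / i and (ij)^(k+1) divides m / p, so i and p are vertices on the two sides of
   the cut. *)
- exists ((U_(i) + U_(j)) *+ k + (U_(p) + U_(q)))%MM.
    by rewrite -addn1; apply: edge_prodD; last exact: edge_prod1.
  apply/mnm_lepP => t; rewrite mnmBE /m !(mnmDE, mulmnE, mnm1E).
  by rewrite mulnS; lia.
exists ((U_(i) + U_(j)) *+ k.+1)%MM => //; apply: lep_addB.
by apply/mnm_lepP => t; rewrite /m !mnmDE; lia.
Qed.

End PowersOfEdgeIdeals.

Theorem theorem2p1 (K : fieldType) (n : nat) (G : loopgraph n) :
  [<-> gap_free G;
       forall k : nat, (1 <= k)%N ->
         enat_lt (Fin 1) (ideal_index (ideal_pow (edge_ideal K G) k));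
       exists k : nat, (1 <= k)%N /\
         enat_lt (Fin 1) (ideal_index (ideal_pow (edge_ideal K G) k))].
Proof.
split; first by move=> gapG k _; apply: gap_free_index.
split; first by move=> h; exists 1%N; split=> //; apply: h.
by case=> k [k0]; apply: index_gap_free.
Qed.
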